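(* Let $\gamma=[\gamma_r,\dots,\gamma_1]=(C=F_r\supset F'_r\subset F_{r-1}\supset\cdots\supset F'_1\subset F_0\supset F'_0)\in\hat\Sigma^c(\tau)$ be a combinatorial gallery. The cell $\mathcal C^\gamma=\rho^{-1}(\gamma)$ can be written as $$\mathcal C^\gamma=\{(x_r,\dots,x_1)\in U^\gamma:\ x_j=0\ \text{ if } j\notin J(\gamma)\}.$$
   Context: Setting. $k$ is an algebraically closed field; a variety is a reduced separated $k$-scheme of finite type and points are closed points. $G$ is a connected semi-simple group of adjoint type over $k$, $T\subset B\subset G$ a maximal torus and a Borel subgroup, $W=N_G(T)/T$, $R$ the root system of $(G,T)$, $R_0$ the simple roots for $B$, $S=\{s_\alpha:\alpha\in R_0\}$. For each $\alpha\in R$ a generator $X_\alpha$ of the root space of $\alpha$ in $\mathrm{Lie}(G)$ is chosen, $p_\alpha(\lambda)=\exp(\mathrm{ad}(\lambda X_\alpha))$ is the corresponding morphism from the additive group to $G$, and $U(\alpha)$ is its image. The choices (including representatives in $N_G(T)$ of the simple reflections, again written $s_\alpha$) are such that $s_\alpha p_\beta(\lambda)s_\alpha^{-1}=p_{s_\alpha(\beta)}(n_{\alpha\beta}\lambda)$ with $n_{\alpha\beta}=\pm1$, for $\alpha\in R_0$, $\beta\in R$. Building. A parabolic subgroup has type $t\subset S$ if it is conjugate to $BW_tB$, where $W_t=\langle t\rangle$. $\Delta(G)$ is the simplicial complex of parabolic subgroups of $G$ ordered by reverse inclusion; $F_Q$ is the face attached to $Q$; chambers correspond to Borel subgroups;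 facets are faces of type $\{s_\alpha\}$, $\alpha\in R_0$. $C=F_B$. $G$ acts by $y(F_Q)=F_{yQy^{-1}}$. The apartment $\mathbb A$ consists of the parabolics containing $T$. For $\beta\in R$ the wall $M_\beta=M_{-\beta}$ is the subcomplex of faces of $\mathbb A$ fixed by $s_\beta$; it separates chambers $v(C)$ and $v'(C)$ ($v,v'\in W$) iff exactly one of $v^{-1}\beta,v'^{-1}\beta$ is positive. The retraction $\rho:\Delta(G)\to\mathbb A$ (onto $\mathbb A$ with centre $C$) sends $F_{buQu^{-1}b^{-1}}$ ($b\in B,u\in W,Q\supset B$) to $F_{uQu^{-1}}$; it is applied to galleries face by face. Bott-Samelson variety. Fix a parabolic $P\supset B$ of type $t'_0\subset S$, a class $\overline w\in W/W_{t'_0}$ with minimal length representative $w$, and a reduced decomposition $w=s_{k_r}\cdots s_{k_1}$, where $s_{k_j}=s_{\alpha_{k_j}}$, $\alpha_{k_j}\in R_0$. Let $\tau=(\emptyset\subset\{s_{k_r}\}\supset\emptyset\cdots\{s_{k_1}\}\supset\emptyset\subset t'_0)$. With $P_{k_j}=U(\alpha_{k_j})s_{k_j}B\cup B$, put $\hat\Sigma(\tau)=P_{k_r}\times_B\cdots\times_BP_{k_1}/B$, the quotient of $P_{k_r}\times\cdots\times P_{k_1}$ by $B^r$ acting by $(p_rb_r,b_r^{-1}p_{r-1}b_{r-1},\dots,b_2^{-1}p_1b_1)$; its points are written $[g_r,\dots,g_1]$. The point $[g_r,\dots,g_1]$ is identified with the gallery (sequence of faces) $(E_r\supset E'_r\subset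 E_{r-1}\supset\cdots\supset E'_1\subset E_0\supset E'_0)$ of type $\tau$ and source $C$, where $E_i=g_r\cdots g_{i+1}(C)$, $E'_j=g_r\cdots g_{j+1}(F_{t'_j})$ for $j\ge1$ with $F_{t'_j}$ the face of $C$ of type $t'_j=\{s_{k_j}\}$, and $E'_0=g_r\cdots g_1(F_P)$ is its target. Combinatorial galleries and cells. $\hat\Sigma^c(\tau)$ is the finite set of galleries $\gamma=[\gamma_r,\dots,\gamma_1]$ with each $\gamma_j\in\{1,s_{k_j}\}$ (those contained in $\mathbb A$). $U^\gamma\subset\hat\Sigma(\tau)$ is the affine open set with coordinates $(x_r,\dots,x_1)$ given by the points $[g_r,\dots,g_1]$ with $g_j=p_{\alpha_{k_j}}(x_j)s_{k_j}$ if $\gamma_j=s_{k_j}$ and $g_j=p_{-\alpha_{k_j}}(x_j)$ if $\gamma_j=1$. $\mathcal C^\gamma=\rho^{-1}(\gamma)$ is the set of galleries in $\hat\Sigma(\tau)$ that retract onto $\gamma$. Put $\beta_j=\gamma_r\cdots\gamma_j(\alpha_{k_j})$ for $r\ge j\ge1$; $J(\gamma)\subset\{r,\dots,1\}$ is the set of $j$ such that $M_{\beta_j}$ is a load-bearing wall of $\gamma$, i.e. separates $F_{j-1}$ from $C$. *)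

(* Defs.v *)
From HB Require Import structures.
From mathcomp Require Import all_boot all_order all_algebra.
From mathcomp Require Import mpoly.
From mathcomp Require Import boolp classical_sets.

Set Implicit Arguments.
Unset Strict Implicit.
Unset Printing Implicit Defensive.

Import GRing.Theory.

Local Open Scope classical_set_scope.
Local Open Scope ring_scope.

(** * Linear algebraic groups

   A linear algebraic group over the algebraically closed field [K] is a Zariski
   closed subgroup of GL_(n+1)(K), given by its set of closed points. *)
Section LinearAlgebraicGroups.
Variables (K : closedFieldType) (n : nat).
Local Notation M := 'M[K]_n.+1.
Implicit Types (A G T B : set M).

Definition coords (g : M) : 'I_(n.+1 * n.+1) -> K := fun i => mxvec g 0 i.

(* Equations with a power of 1/det define the same closed sets of GL. *)
Definition zclosed A : Prop :=
  exists I : set {mpoly K[n.+1 * n.+1]},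
    A = [set g | g \is a GRing.unit /\ forall f, I f -> f.@[coords g] = 0].

Definition subgroup A : Prop :=
  [/\ forall g, A g -> g \is a GRing.unit,
      A 1,
      forall g h, A g -> A h -> A (g * h)
    & forall g, A g -> A g^-1].

Definition zconnected A : Prop :=
  forall A1 A2, zclosed A1 -> zclosed A2 ->
    A = A1 `|` A2 -> A1 `&` A2 = set0 -> A1 = set0 \/ A2 = set0.

Definition closed_subgroup A : Prop := subgroup A /\ zclosed A.

Definition conj (y : M) A : set M := [set y * a * y^-1 | a in A].

Definition normalizer G A : set M := [set y | G y /\ conj y A = A].

Definition derived_group A : set M :=
  [set x | forall H, subgroup H ->
     (forall a b, A a -> A b -> H (a^-1 * b^-1 * a * b)) -> H x].

Definition is_solvable A : Prop :=
  exists m, iter m derived_group A `<=` [set 1].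

Definition is_torus A : Prop :=
  [/\ closed_subgroup A, zconnected A
    & exists2 y : M, y \is a GRing.unit &
        forall t, A t -> is_diag_mx (y * t * y^-1)].

Definition is_maximal_torus G T : Prop :=
  [/\ is_torus T, T `<=` G
    & forall T', is_torus T' -> T' `<=` G -> T `<=` T' -> T' = T].

Definition is_Borel G B : Prop :=
  let csc B' := [/\ closed_subgroup B', zconnected B', is_solvable B' & B' `<=` G] in
  csc B /\ forall B', csc B' -> B `<=` B' -> B' = B.

Definition is_parabolic G A : Prop :=
  [/\ closed_subgroup A, A `<=` G & exists2 B, is_Borel G B & B `<=` A].

(* Semi-simplicity is the triviality of the radical. *)
Definition connected_semisimple G : Prop :=
  [/\ closed_subgroup G, zconnected G
    & forall A, closed_subgroup A -> zconnected A -> is_solvable A -> A `<=` G ->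
        (forall y, G y -> conj y A = A) -> A = [set 1]].

(** The tangent space of [G] at the identity; the bracket is the commutator. *)
Definition Lie G : set M :=
  [set Y | forall f : {mpoly K[n.+1 * n.+1]},
     (forall g, G g -> f.@[coords g] = 0) ->
     \sum_i f^`M(i).@[coords 1] * coords Y i = 0].

Definition ad (X Y : M) : M := X * Y - Y * X.

(** * Characters and roots

   A character of [T] is extended by 0 to all matrices, so that equality of
   characters is equality of functions; the group law of X(T) is then the
   pointwise product, written multiplicatively. *)
Definition is_character T (chi : M -> K) : Prop :=
  [/\ forall t, ~ T t -> chi t = 0,
      forall t, T t -> chi t != 0,
      forall t u, T t -> T u -> chi (t * u) = chi t * chi u
    & exists (f : {mpoly K[n.+1 * n.+1]}) (m : nat),
        forall t, T t -> chi t = f.@[coords t] / \det t ^+ m].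

Definition char_opp (chi : M -> K) : M -> K := fun t => (chi t)^-1.

(* The combination \sum_i m_i chi_i in additive notation. *)
Definition char_comb T (I : finType) (chi : I -> M -> K) (m : I -> int) : M -> K :=
  fun t => if t \in T then \prod_i chi i t ^ m i else 0.

(* The action of W on X(T), through a representative [w] in N_G(T). *)
Definition char_act (w : M) (chi : M -> K) : M -> K :=
  fun t => chi (w^-1 * t * w).

Definition root_space G T (beta : M -> K) : set M :=
  [set Y | Lie G Y /\ forall t, T t -> t * Y * t^-1 = beta t *: Y].

Definition is_root G T (beta : M -> K) : Prop :=
  [/\ is_character T beta,
      exists2 t, T t & beta t != 1
    & exists2 Y, root_space G T beta Y & Y != 0].

(* X(T) is the root lattice. *)
Definition adjoint_type G T : Prop :=
  forall chi, is_character T chi ->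
    exists (q : nat) (beta : 'I_q -> M -> K) (m : 'I_q -> int),
      (forall i, is_root G T (beta i)) /\ chi = char_comb T beta m.

(* [w] represents the reflection of X(T) along [alpha], which maps chi to
   chi - m alpha with m an integer depending on chi, and alpha to -alpha. *)
Definition represents_reflection G T (alpha : M -> K) (w : M) : Prop :=
  [/\ normalizer G T w,
      char_act w alpha = char_opp alpha
    & forall chi, is_character T chi ->
        exists m : int, char_act w chi = (fun t => chi t * alpha t ^ m)].

(* [p] is the one-parameter subgroup exp(ad(lambda X)).  The exponential series
   sum_m lambda^m ad(X)^m / m! acting on Lie(G) is written with divided powers
   [D m] (so that m! D_m = ad(X)^m), since the characteristic is arbitrary. *)
Record is_exp_ad G T (beta : M -> K) (X : M) (p : K -> M) : Prop := IsExpAd {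
  exp_in : forall x, G (p x);
  exp_add : forall x y, p (x + y) = p x * p y;
  exp_morphism : exists2 P : 'M[{poly K}]_n.+1,
      (forall x, p x = map_mx (fun f : {poly K} => f.[x]) P)
    & X = map_mx (fun f : {poly K} => f^`().[0]) P;
  exp_torus : forall t x, T t -> t * p x * t^-1 = p (beta t * x);
  exp_series : exists (N : nat) (D : nat -> M -> M), forall Y, Lie G Y ->
      (forall x, p x * Y * (p x)^-1 = \sum_(m < N) x ^+ m *: D m Y) /\
      (forall m, (m`!)%:R *: D m Y = iter m (ad X) Y)
}.

End LinearAlgebraicGroups.

(** * The group, its root system and the chosen generators *)
Record group_setting (K : closedFieldType) (n : nat) := GroupSetting {
  gG : set 'M[K]_n.+1;
  gT : set 'M[K]_n.+1;
  gB : set 'M[K]_n.+1;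
  (* the number of simple roots and the simple roots *)
  rk : nat;
  sroot : 'I_rk -> 'M[K]_n.+1 -> K;
  (* X_beta and p_beta; only their values at roots matter *)
  rvec : ('M[K]_n.+1 -> K) -> 'M[K]_n.+1;
  rp : ('M[K]_n.+1 -> K) -> K -> 'M[K]_n.+1;
  (* representatives in N_G(T) of the simple reflections *)
  srefl : 'I_rk -> 'M[K]_n.+1;

  gG_semisimple : connected_semisimple gG;
  gT_maximal : is_maximal_torus gG gT;
  gG_adjoint : adjoint_type gG gT;
  gB_Borel : is_Borel gG gB;
  gTB : gT `<=` gB;

  rvec_gen : forall beta, is_root gG gT beta ->
    rvec beta != 0 /\ root_space gG gT beta = range (fun c : K => c *: rvec beta);
  rp_exp : forall beta, is_root gG gT beta ->
    is_exp_ad gG gT beta (rvec beta) (rp beta);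

  (* the simple roots form the base of the root system whose positive roots are
     the roots beta with U(beta) contained in B *)
  sroot_root : forall i, is_root gG gT (sroot i);
  sroot_free : forall m m' : 'I_rk -> int,
    char_comb gT sroot m = char_comb gT sroot m' -> m = m';
  sroot_base : forall beta, is_root gG gT beta ->
    exists2 m : 'I_rk -> int, beta = char_comb gT sroot m &
      (forall i, (0 <= m i)%R) \/ (forall i, (m i <= 0)%R);
  sroot_positive : forall beta, is_root gG gT beta ->
    (range (rp beta) `<=` gB <->
     exists2 m : 'I_rk -> int, beta = char_comb gT sroot m &
       forall i, (0 <= m i)%R);

  srefl_refl : forall i, represents_reflection gG gT (sroot i) (srefl i);
  srefl_rp : forall i beta, is_root gG gT beta ->
    exists2 nu : K, nu = 1 \/ nu = -1 &
      forall x, srefl i * rp beta x * (srefl i)^-1 =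
                rp (char_act (srefl i) beta) (nu * x)
}.
Arguments sroot {K n} g i _ : rename.
Arguments srefl {K n} g i : rename.

Section BottSamelson.
Variables (K : closedFieldType) (n : nat) (D : group_setting K n).
Local Notation M := 'M[K]_n.+1.
Local Notation G := (gG D).
Local Notation T := (gT D).
Local Notation B := (gB D).
Local Notation simple := ('I_(rk D)).

Definition U (beta : M -> K) : set M := range (rp D beta).

Definition positive (beta : M -> K) : Prop := is_root G T beta /\ U beta `<=` B.

(** ** The Weyl group: elements of W = N_G(T)/T are handled through
   representatives, and words are sequences of indices of simple reflections. *)
Definition word (u : seq simple) : M := \prod_(i <- u) srefl D i.

Definition expresses (u : seq simple) (w : M) : Prop := T (w^-1 * word u).

Definition reduced_decomposition (u : seq simple) (w : M) : Prop :=
  expresses u w /\ forall u', expresses u' w -> (size u <= size u')%N.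

Definition has_length (w : M) (m : nat) : Prop :=
  exists2 u, reduced_decomposition u w & size u = m.

(* [w] has minimal length in its class modulo W_t. *)
Definition minimal_representative (t : {set simple}) (w : M) : Prop :=
  forall v m m', all (fun i => i \in t) v ->
    has_length w m -> has_length (w * word v) m' -> (m <= m')%N.

(** ** The building: the face F_Q is represented by the parabolic subgroup Q,
   and the action of y on faces is [conj y]. *)
Definition BWB (t : {set simple}) : set M :=
  [set x | exists b u b', [/\ B b, all (fun i => i \in t) u, B b'
                            & x = b * word u * b']].

Definition parabolic_of_type (t : {set simple}) (Q : set M) : Prop :=
  is_parabolic G Q /\ exists2 y, G y & Q = conj y (BWB t).

(* By the Bruhat decomposition G = BWB, this formula determines [rho] on every
   face and is consistent. *)
Definition is_retraction (rho : set M -> set M) : Prop :=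
  forall b u Q, B b -> normalizer G T u -> is_parabolic G Q -> B `<=` Q ->
    rho (conj (b * u) Q) = conj u Q.

(* The wall M_beta separates the chambers v(C) and v'(C): exactly one of
   v^-1 beta and v'^-1 beta is positive. *)
Definition separates (beta : M -> K) (v v' : M) : Prop :=
  let pv := positive (char_act v^-1 beta) in
  let pv' := positive (char_act v'^-1 beta) in
  (pv /\ ~ pv') \/ (~ pv /\ pv').

(* P_i = U(alpha_i) s_i B `|` B, the parabolic subgroup of type {s_i} containing
   B; as a face it is the facet of type {s_i} of the chamber C. *)
Definition minpar (i : simple) : set M :=
  [set x | exists g b, [/\ U (sroot D i) g, B b & x = g * srefl D i * b]] `|` B.

(** ** The Bott-Samelson variety

   [d] is the sequence k_r, ..., k_1.  Sequences indexed by r, ..., 1 are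
   functions on ['I_r], read from left to right: the position [q] stands for the
   index j = r - q. *)
Section Galleries.
Variables (r : nat) (d : r.-tuple simple).

(* The product of the first [m] entries: g_r ... g_(r-m+1). *)
Definition prefix_prod (g : 'I_r -> M) (m : nat) : M := \prod_(q < r | (q < m)%N) g q.

Definition in_minpars (g : 'I_r -> M) : Prop := forall q, minpar (tnth d q) (g q).

(* b (q+1) is the element b_(r-q) of B acting on the right of the entry at
   position q, so that h_j = b_(j+1)^-1 g_j b_j with b_(r+1) = 1. *)
Definition bs_equiv (g h : 'I_r -> M) : Prop :=
  exists b : nat -> M, [/\ b 0%N = 1, forall q : 'I_r, B (b q.+1)
    & forall q : 'I_r, h q = (b q)^-1 * g q * b q.+1].

(* The point [g_r, ..., g_1], as an orbit of B^r. *)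
Definition bs_point (g : 'I_r -> M) : set ('I_r -> M) :=
  [set h | in_minpars h /\ bs_equiv g h].

Definition bott_samelson : set (set ('I_r -> M)) :=
  [set bs_point g | g in in_minpars].

(* The sequence of faces (E_r, E'_r, E_(r-1), ..., E'_1, E_0, E'_0), where E'_0
   is a translate of F_P. *)
Definition gallery (P : set M) (g : 'I_r -> M) : seq (set M) :=
  flatten [seq [:: conj (prefix_prod g q) B;
                   conj (prefix_prod g q) (minpar (tnth d q))] | q : 'I_r <- enum 'I_r]
  ++ [:: conj (prefix_prod g r) B; conj (prefix_prod g r) P].

(* The combinatorial gallery with gamma_j = s_(k_j) if [e] is true at the
   position of j, and gamma_j = 1 otherwise. *)
Definition comb_word (e : 'I_r -> bool) : 'I_r -> M :=
  fun q => if e q then srefl D (tnth d q) else 1.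

Definition chart_word (e : 'I_r -> bool) (x : 'I_r -> K) : 'I_r -> M :=
  fun q => let alpha := sroot D (tnth d q) in
    if e q then rp D alpha (x q) * srefl D (tnth d q)
    else rp D (char_opp alpha) (x q).

(* The point of U^gamma with coordinates [x]. *)
Definition chart (e : 'I_r -> bool) (x : 'I_r -> K) : set ('I_r -> M) :=
  bs_point (chart_word e x).

(* C^gamma = rho^-1(gamma); [rho] is applied to galleries face by face. *)
Definition cell (rho : set M -> set M) (P : set M) (e : 'I_r -> bool) :
    set (set ('I_r -> M)) :=
  [set y | bott_samelson y /\
     exists g, [/\ in_minpars g, y = bs_point g
       & [seq rho F | F <- gallery P g] = gallery P (comb_word e)]].

Definition gallery_root (e : 'I_r -> bool) (q : 'I_r) : M -> K :=
  char_act (prefix_prod (comb_word e) q.+1) (sroot D (tnth d q)).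

(* At position q = r - j, the chamber F_(j-1) is gamma_r ... gamma_j (C). *)
Definition load_bearing (e : 'I_r -> bool) (q : 'I_r) : Prop :=
  separates (gallery_root e q) (prefix_prod (comb_word e) q.+1) 1.

End Galleries.
End BottSamelson.

Arguments word {K n} D u.
Arguments expresses {K n} D u w.
Arguments reduced_decomposition {K n} D u w.
Arguments has_length {K n} D w m.
Arguments minimal_representative {K n} D t w.
Arguments BWB {K n} D t.
Arguments parabolic_of_type {K n} D t Q.
Arguments minpar {K n} D i.
Arguments in_minpars {K n} D {r} d g.
Arguments bs_equiv {K n} D {r} g h.
Arguments bs_point {K n} D {r} d g.
Arguments bott_samelson {K n} D {r} d.
Arguments gallery {K n} D {r} d P g.
Arguments comb_word {K n} D {r} d e.
Arguments chart_word {K n} D {r} d e x.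
Arguments chart {K n} D {r} d e x.
Arguments cell {K n} D {r} d rho P e.
Arguments gallery_root {K n} D {r} d e q.
Arguments load_bearing {K n} D {r} d e q.

(* Main.v *)
(* Conjugating p_beta by a product v of simple reflections gives p_(v beta) up to
   a sign, so U(gamma) with v gamma > 0 can be moved from the right of v into B
   on its left.  Writing s, alpha for the reflection and root of the current
   entry and b v b' for the product of the previous ones, the two decompositions
   P_i = U(alpha) s B `|` B = U(-alpha) B `|` s B, used according to the sign of
   v alpha, show that a gallery retracts onto gamma exactly when, up to B^r, each
   entry is p_alpha(x) s or p_(-alpha)(x) with x = 0 unless beta_j < 0; and
   M_(beta_j) is load-bearing iff beta_j < 0, because
   (gamma_r ... gamma_j)^-1 beta_j = alpha > 0. *)
Require Import Defs.
From mathcomp Require Import all_boot all_order all_algebra.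
From mathcomp Require Import mpoly.
From mathcomp Require Import boolp classical_sets.

Set Implicit Arguments.
Unset Strict Implicit.
Unset Printing Implicit Defensive.

Import GRing.Theory.
Local Open Scope classical_set_scope.
Local Open Scope ring_scope.

(** * Directional derivatives of polynomials and the chain rule *)

Section DirectionalDerivative.
Variables (K : comNzRingType).

(** Up to unfolding, [Lie G] is cut out by the forms [dirder f (coords 1) (coords Y)] with [f]
    vanishing on [G]. *)
Definition dirder k (f : {mpoly K[k]}) (v y : 'I_k -> K) : K :=
  \sum_i f^`M(i).@[v] * y i.

Lemma dirderC k c (v y : 'I_k -> K) : dirder c%:MP v y = 0.
Proof. by rewrite /dirder big1 // => i _; rewrite mderivC meval0 mul0r. Qed.

Lemma dirderD k (f g : {mpoly K[k]}) v y :
  dirder (f + g) v y = dirder f v y + dirder g v y.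
Proof.
rewrite /dirder -big_split /=; apply: eq_bigr => i _.
by rewrite mderivD mevalD mulrDl.
Qed.

Lemma dirderZ k c (f : {mpoly K[k]}) v y : dirder (c *: f) v y = c * dirder f v y.
Proof.
rewrite /dirder mulr_sumr; apply: eq_bigr => i _.
by rewrite mderivZ mevalZ mulrA.
Qed.

Lemma dirderM k (f g : {mpoly K[k]}) v y :
  dirder (f * g) v y = dirder f v y * g.@[v] + f.@[v] * dirder g v y.
Proof.
rewrite /dirder mulr_suml mulr_sumr -big_split /=; apply: eq_bigr => i _.
by rewrite mderivM mevalD !mevalM mulrDl mulrAC mulrA.
Qed.

Lemma dirderX k i (v y : 'I_k -> K) : dirder 'X_i v y = y i.
Proof.
rewrite /dirder (bigD1 i) //= big1 => [|j ji]; rewrite mderivX mnm1E.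
  rewrite eqxx scale1r; have -> : (U_(i) - U_(i) = 0)%MM.
    by apply/mnmP => j; rewrite mnmBE mnm0E subnn.
  by rewrite mpolyX0 meval1 mul1r addr0.
by rewrite eq_sym (negPf ji) scale0r meval0 mul0r.
Qed.

Lemma dirder_sum k (I : finType) (F : I -> {mpoly K[k]}) v y :
  dirder (\sum_i F i) v y = \sum_i dirder (F i) v y.
Proof.
apply: (big_morph (fun f => dirder f v y) (fun f g => dirderD f g v y)).
by rewrite -mpolyC0 dirderC.
Qed.

Definition chain_rule_for k l (q : 'I_k -> {mpoly K[l]}) (f : {mpoly K[k]}) :=
  exists f' : {mpoly K[l]},
    (forall v, f'.@[v] = f.@[fun i => (q i).@[v]]) /\
    (forall v y, dirder f' v y =
       dirder f (fun i => (q i).@[v]) (fun i => dirder (q i) v y)).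

Lemma chain_ruleM k l (q : 'I_k -> {mpoly K[l]}) f g :
  chain_rule_for q f -> chain_rule_for q g -> chain_rule_for q (f * g).
Proof.
move=> [f' [ef df]] [g' [eg dg]]; exists (f' * g'); split=> [v|v y].
  by rewrite !mevalM ef eg.
by rewrite !dirderM ef eg df dg.
Qed.

(** Constants and variables have an evident composite and products preserve the property, so
    monomials have it; the outer induction adds one scaled monomial at a time. *)
Lemma chain_rule k l (q : 'I_k -> {mpoly K[l]}) (f : {mpoly K[k]}) :
  chain_rule_for q f.
Proof.
have cC c : chain_rule_for q c%:MP.
  by exists c%:MP; split=> [v|v y]; rewrite ?mevalC ?dirderC.
elim/mpolyind: f => [|c m f _ _ [f' [ef df]]]; first by rewrite -mpolyC0; exact: cC.
have [g [eg dg]] : chain_rule_for q 'X_[m].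
  rewrite mpolyXE_id; elim/big_ind: _ => [|*|i _]; first by rewrite -mpolyC1; exact: cC.
    exact: chain_ruleM.
  elim: (m i) => [|p IHp]; first by rewrite expr0 -mpolyC1; exact: cC.
  rewrite exprS; apply: chain_ruleM => //.
  by exists (q i); split=> [v|v y]; rewrite ?mevalXU ?dirderX.
exists (c *: g + f'); split=> [v|v y].
  by rewrite !mevalD !mevalZ ef eg.
by rewrite !dirderD !dirderZ df dg.
Qed.

End DirectionalDerivative.

(** * Conjugation acting on the Lie algebra, on characters and on roots *)

Section LieConjugation.
Variables (K : closedFieldType) (n : nat).
Local Notation M := 'M[K]_n.+1.

(** Conjugation is linear in the matrix entries, so [f'] arises from [f] by substituting the linear
    forms [q]. The values serve for characters, the derivatives for the Lie algebra. *)
Lemma mpoly_conj (w : M) (f : {mpoly K[n.+1 * n.+1]}) :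
  exists f' : {mpoly K[n.+1 * n.+1]},
    (forall g, f'.@[coords g] = f.@[coords (w * g * w^-1)]) /\
    (forall g Y, dirder f' (coords g) (coords Y) =
       dirder f (coords (w * g * w^-1)) (coords (w * Y * w^-1))).
Proof.
pose L := lin_mx (mulmxr w^-1 \o mulmx w : {linear M -> M}).
pose q i : {mpoly K[n.+1 * n.+1]} := \sum_j L j i *: 'X_j.
have cL g i : coords (w * g * w^-1) i = \sum_j L j i * coords g j.
  have <- : (mulmxr w^-1 \o mulmx w : {linear M -> M}) g = w * g * w^-1 by [].
  rewrite /coords -mul_vec_lin mxE.
  by apply: eq_bigr => j _; rewrite mulrC.
have [f' [ef df]] := chain_rule q f; exists f'; split=> [g|g Y].
  rewrite ef; congr (_.@[_]); apply/funext => i; rewrite cL raddf_sum.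
  by apply: eq_bigr => j _; rewrite /= mevalZ mevalXU.
rewrite df; congr dirder; apply/funext => i; rewrite cL.
  by rewrite raddf_sum; apply: eq_bigr => j _; rewrite /= mevalZ mevalXU.
by rewrite dirder_sum; apply: eq_bigr => j _; rewrite dirderZ dirderX.
Qed.

Lemma subgroup_conj (A : set M) x z : subgroup A -> A x -> A z -> A (x * z * x^-1).
Proof. by move=> [_ _ AM AV] Ax Az; apply: (AM); [exact: AM|exact: AV]. Qed.

(** If [f] vanishes on [G], so does its pullback [f']. Conjugation fixes 1, so the derivative of
    [f'] at 1 along [Y] is that of [f] along the conjugate of [Y]. *)
Lemma Lie_conj (G : set M) (w : M) : subgroup G -> G w ->
  forall Y, Lie G Y -> Lie G (w * Y * w^-1).
Proof.
move=> sgG Gw Y LY f f0; have [Gu _ _ _] := sgG.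
have [f' [ef df]] := mpoly_conj w f.
have := df 1 Y; rewrite mulr1 divrr ?Gu // /dirder => <-.
by apply: LY => g Gg; rewrite ef f0 //; exact: subgroup_conj.
Qed.

Lemma conjP (A : set M) (y x : M) : y \is a GRing.unit ->
  conj y A x <-> A (y^-1 * x * y).
Proof.
move=> yu; split=> [[a Aa <-]|Ax]; first by rewrite !mulrA mulVr // mul1r mulrVK.
by exists (y^-1 * x * y) => //; rewrite !mulrA divrr // mul1r mulrK.
Qed.

Lemma conjM (A : set M) (x y : M) : x \is a GRing.unit -> y \is a GRing.unit ->
  conj (x * y) A = conj x (conj y A).
Proof.
move=> xu yu; have xyu : x * y \is a GRing.unit by rewrite unitrMl.
by apply/funext => z; apply/propext; rewrite !conjP // invrM // !mulrA.
Qed.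

Lemma conj1 (A : set M) : conj 1 A = A.
Proof. by apply/seteqP; split=> z; rewrite conjP ?unitr1 // invr1 mul1r mulr1. Qed.

Lemma conj_subgroup (A : set M) (x : M) : subgroup A -> A x -> conj x A = A.
Proof.
move=> sgA Ax; have [Au _ _ AV] := sgA; have xu := Au _ Ax.
apply/seteqP; split=> z; rewrite conjP // => Az; last first.
  by rewrite -{2}[x]invrK; apply: subgroup_conj => //; exact: AV.
have -> : z = x * (x^-1 * z * x) * x^-1.
  by rewrite !mulrA divrr // mul1r mulrK.
exact: subgroup_conj.
Qed.

Lemma char_actM (x y : M) (chi : M -> K) :
  x \is a GRing.unit -> y \is a GRing.unit ->
  char_act (x * y) chi = char_act x (char_act y chi).
Proof. by move=> xu yu; apply/funext => t; rewrite /char_act invrM // !mulrA. Qed.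

Lemma char_act1 (chi : M -> K) : char_act 1 chi = chi.
Proof. by apply/funext => t; rewrite /char_act invr1 mul1r mulr1. Qed.

Lemma char_actK (x : M) (chi : M -> K) : x \is a GRing.unit ->
  char_act x^-1 (char_act x chi) = chi.
Proof. by move=> xu; rewrite -char_actM ?unitrV // mulVr // char_act1. Qed.

Lemma char_oppK : involutive (@char_opp K n).
Proof. by move=> chi; apply/funext => t; rewrite /char_opp invrK. Qed.

Lemma char_act_opp (x : M) (chi : M -> K) :
  char_act x (char_opp chi) = char_opp (char_act x chi).
Proof. by []. Qed.

Lemma char_comb_opp (T : set M) (I : finType) (chi : I -> M -> K) (m : I -> int) :
  char_opp (char_comb T chi m) = char_comb T chi (fun i => - m i).
Proof.
apply/funext => t; rewrite /char_opp /char_comb; case: ifP => _; last by rewrite invr0.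
by rewrite -prodfV; apply: eq_bigr => i _; rewrite invr_expz.
Qed.

Lemma char_comb_delta (T : set M) (I : finType) (chi : I -> M -> K) (j : I) :
  is_character T (chi j) -> char_comb T chi (fun i => (i == j)%:Z) = chi j.
Proof.
move=> [c0 _ _ _]; apply/funext => t; rewrite /char_comb; case: ifPn => [_|].
  by rewrite (bigD1 j) //= eqxx big1 ?mulr1 // => i /negPf ->.
by rewrite notin_setE => /c0.
Qed.

Section NormalizerAction.
Variables (G T : set M).
Hypotheses (sgG : subgroup G) (sgT : subgroup T).

Lemma normalizer_unit w : normalizer G T w -> w \is a GRing.unit.
Proof. by case: sgG => Gu _ _ _ [/Gu]. Qed.

Lemma normalizer1 : normalizer G T 1.
Proof. by case: sgG => _ G1 _ _; split=> //; exact: conj1. Qed.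

Lemma normalizerM v w : normalizer G T v -> normalizer G T w ->
  normalizer G T (v * w).
Proof.
move=> Nv Nw; case: (Nv) (Nw) => [Gv Tv] [Gw Tw].
split; first by case: sgG => _ _ GM _; exact: GM.
by rewrite conjM ?Tw //; exact: normalizer_unit.
Qed.

Lemma normalizer_conj w t : normalizer G T w -> T t -> T (w * t * w^-1).
Proof. by move=> [_ Tw] Tt; rewrite -Tw; exists t. Qed.

Lemma normalizer_conjV w t : normalizer G T w -> T (w^-1 * t * w) <-> T t.
Proof. by move=> Nw; case: (Nw) => _ Tw; rewrite -conjP ?Tw //; exact: normalizer_unit. Qed.

Lemma character_act w chi : normalizer G T w -> is_character T chi ->
  is_character T (char_act w chi).
Proof.
move=> Nw [c0 cn cM [f [m cf]]]; have wu := normalizer_unit Nw; split.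
- by move=> t Tt; apply: c0; rewrite normalizer_conjV.
- by move=> t Tt; apply: cn; rewrite normalizer_conjV.
- move=> t u Tt Tu; rewrite /char_act -cM ?normalizer_conjV //.
  by rewrite !mulrA mulrK.
(* Only the numerator has to be pulled back: the determinant is invariant under conjugation, so the
   exponent [m] is kept. *)
have [f' [ef _]] := mpoly_conj w^-1 f.
exists f', m => t Tt; rewrite /char_act cf ?normalizer_conjV // ef invrK.
by rewrite !det_mulmx det_inv mulrAC mulVr ?mul1r.
Qed.

(** If [Y] is a root vector for [beta], then [w * Y * w^-1] is one for the transported character. *)
Lemma root_act w beta : normalizer G T w -> is_root G T beta ->
  is_root G T (char_act w beta).
Proof.
move=> Nw [cb [t Tt bt] [Y [LY TY] Y0]]; have wu := normalizer_unit Nw; split.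
- exact: character_act.
- exists (w * t * w^-1); first exact: normalizer_conj.
  by rewrite /char_act !mulrA mulVr // mul1r mulrVK.
exists (w * Y * w^-1); last first.
  apply: contra_neq Y0 => wY.
  have -> : Y = w^-1 * (w * Y * w^-1) * w by rewrite !mulrA mulVr // mul1r mulrVK.
  by rewrite wY mulr0 mul0r.
split=> [|u Tu]; first by apply: Lie_conj => //; case: Nw.
have Tv : T (w^-1 * u * w) by rewrite normalizer_conjV.
have tu : u \is a GRing.unit by case: sgT => Tun _ _ _; exact: Tun.
have /(congr1 (fun Z => w * Z * w^-1)) := TY _ Tv.
rewrite /char_act -scalerAr -scalerAl => <-.
rewrite !invrM ?unitrV ?unitrMl ?unitrV // invrK !mulrA divrr // mul1r mulrK //.
Qed.

End NormalizerAction.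
End LieConjugation.

(** * Root subgroups, reflections and positivity *)

Section Building.
Variables (K : closedFieldType) (n : nat) (D : group_setting K n).
Local Notation M := 'M[K]_n.+1.
Local Notation G := (gG D).
Local Notation T := (gT D).
Local Notation B := (gB D).
Local Notation simple := ('I_(rk D)).
Local Notation s := (srefl D).
Local Notation p := (rp D).
Local Notation root := (is_root G T).

Lemma G_subgroup : subgroup G.
Proof. by case: (gG_semisimple D) => [[]]. Qed.

Lemma T_subgroup : subgroup T.
Proof. by case: (gT_maximal D) => [[[]]]. Qed.

Lemma B_subgroup : subgroup B.
Proof. by case: (gB_Borel D) => [[[]]]. Qed.

Lemma B_parabolic : is_parabolic G B.
Proof. by case: (gB_Borel D) => [[? ? ? ?] ?]; split=> //; exists B. Qed.

Lemma G_unit g : G g -> g \is a GRing.unit.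
Proof. by case: G_subgroup => Gu _ _ _; exact: Gu. Qed.

Lemma B_sub_G b : B b -> G b.
Proof. by case: (gB_Borel D) => [[? ? ? BG] _]; exact: BG. Qed.

Lemma B_unit b : B b -> b \is a GRing.unit.
Proof. by move/B_sub_G/G_unit. Qed.

Lemma B1 : B 1. Proof. by case: B_subgroup. Qed.

Lemma BM b c : B b -> B c -> B (b * c).
Proof. by case: B_subgroup => _ _ + _; exact. Qed.

Lemma BV b : B b -> B b^-1.
Proof. by case: B_subgroup => _ _ _; exact. Qed.

Lemma srefl_normalizer i : normalizer G T (s i).
Proof. by case: (srefl_refl i). Qed.

Lemma srefl_unit i : s i \is a GRing.unit.
Proof. by have := srefl_normalizer i => -[/G_unit]. Qed.

Lemma char_act_srefl i : char_act (s i) (sroot D i) = char_opp (sroot D i).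
Proof. by case: (srefl_refl i). Qed.

Lemma rp_unit beta x : root beta -> p beta x \is a GRing.unit.
Proof. by move=> /(rp_exp (g := D)) pb; apply: G_unit; exact: exp_in pb x. Qed.

Lemma rpD beta x y : root beta -> p beta (x + y) = p beta x * p beta y.
Proof. by move=> /(rp_exp (g := D)) pb; exact: exp_add pb x y. Qed.

Lemma rp0 beta : root beta -> p beta 0 = 1.
Proof.
move=> rb; have := rpD 0 0 rb; rewrite addr0 => /(congr1 (fun z => (p beta 0)^-1 * z)).
by rewrite mulrA mulVr ?rp_unit // mul1r.
Qed.

Lemma rpN beta x : root beta -> p beta (- x) = (p beta x)^-1.
Proof.
move=> rb; apply: (mulrI (rp_unit x rb)).
by rewrite divrr ?rp_unit // -rpD // subrr rp0.
Qed.

(* The products of simple reflections, for which the sign of the conjugation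
   formula can be controlled. *)
Definition weyl_rep (v : M) : Prop :=
  normalizer G T v /\ forall beta, root beta ->
    exists2 nu : K, nu * nu = 1 &
      forall x, v * p beta x * v^-1 = p (char_act v beta) (nu * x).

Lemma weyl_rep1 : weyl_rep 1.
Proof.
split=> [|beta rb]; first exact: normalizer1 G_subgroup.
by exists 1 => [|x]; rewrite ?mulr1 // char_act1 invr1 mulr1 !mul1r.
Qed.

Lemma weyl_rep_srefl i : weyl_rep (s i).
Proof.
split=> [|beta rb]; first exact: srefl_normalizer.
have [nu nu1 ps] := srefl_rp (g := D) i rb; exists nu => //.
by case: nu1 => ->; rewrite ?mulrNN mulr1.
Qed.

Lemma weyl_rep_unit v : weyl_rep v -> v \is a GRing.unit.
Proof. by case=> [[/G_unit]]. Qed.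

Lemma weyl_repM v w : weyl_rep v -> weyl_rep w -> weyl_rep (v * w).
Proof.
move=> Wv Ww; have [Nv pv] := Wv; have [Nw pw] := Ww.
split=> [|beta rb]; first exact: normalizerM G_subgroup _ _ _ _.
have [nu nu1 pwb] := pw _ rb.
have [mu mu1 pvb] := pv _ (root_act G_subgroup T_subgroup Nw rb).
exists (mu * nu) => [|x]; first by rewrite mulrACA mu1 nu1 mulr1.
rewrite invrM ?weyl_rep_unit // char_actM ?weyl_rep_unit // -(mulrA mu) -pvb -pwb.
by rewrite !mulrA.
Qed.

Lemma weyl_rep_root v beta : weyl_rep v -> root beta -> root (char_act v beta).
Proof. by case=> Nv _; exact: (root_act G_subgroup T_subgroup). Qed.

Lemma weyl_rep_rp v beta x : weyl_rep v -> root beta ->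
  exists y, v * p beta x = p (char_act v beta) y * v.
Proof.
move=> Wv rb; have [_ pv] := Wv; have [nu _ pvb] := pv _ rb; exists (nu * x).
by rewrite -pvb mulrVK // weyl_rep_unit.
Qed.

(** Here the parameter after passing [v] is prescribed: [nu] is its own inverse, so [nu * y]
    works. *)
Lemma rp_weyl_rep v beta y : weyl_rep v -> root beta ->
  exists x, v * p beta x = p (char_act v beta) y * v.
Proof.
move=> Wv rb; have [_ pv] := Wv; have [nu nu1 pvb] := pv _ rb; exists (nu * y).
by rewrite -{2}(mul1r y) -nu1 -(mulrA nu) -pvb mulrVK // weyl_rep_unit.
Qed.

Lemma root_opp i : root (char_opp (sroot D i)).
Proof.
rewrite -char_act_srefl.
by apply: weyl_rep_root; [exact: weyl_rep_srefl|exact: sroot_root].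
Qed.

Lemma rp_sroot_B i x : B (p (sroot D i) x).
Proof.
have : range (p (sroot D i)) `<=` B; last by apply; exists x.
apply/(sroot_positive (sroot_root i)); exists (fun j => (j == i)%:Z) => [|j].
  by rewrite char_comb_delta //; case: (sroot_root i).
by case: eqP.
Qed.

Lemma positive_sroot i : positive D (sroot D i).
Proof. by split=> [|_ [x _ <-]]; [exact: sroot_root|exact: rp_sroot_B]. Qed.

(** Positivity is defined by [U beta] lying in [B]; [sroot_positive] turns it into a sign of
    coordinates in the base, which negation reverses. *)
Lemma positive_or_opp beta : root beta -> root (char_opp beta) ->
  ~ positive D beta -> positive D (char_opp beta).
Proof.
move=> rb ro npos; split=> //; apply/(sroot_positive ro).
have [m bm [m0|m0]] := sroot_base rb.
  by case: npos; split=> //; apply/(sroot_positive rb); exists m.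
exists (fun i => - m i) => [|i]; first by rewrite bm char_comb_opp.
by rewrite Num.Theory.oppr_ge0.
Qed.

(** Otherwise U(-alpha), the conjugate of U(alpha) by [s i], would lie in [B], and -alpha would have
    nonnegative coordinates; by [sroot_free] its coordinate at [i] is -1. *)
Lemma conj_srefl_B i : conj (s i) B <> B.
Proof.
move=> sB.
have : range (p (char_opp (sroot D i))) `<=` B.
  move=> _ [y _ <-]; rewrite -sB conjP ?srefl_unit // -char_act_srefl.
  have [x sx] := rp_weyl_rep y (weyl_rep_srefl i) (sroot_root i).
  by rewrite -mulrA -sx mulKr ?srefl_unit //; exact: rp_sroot_B.
move/(sroot_positive (root_opp i)) => [m + m0].
rewrite -(char_comb_delta (T := T) (chi := sroot D) (j := i)); last first.
  by case: (sroot_root i).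
rewrite char_comb_opp => /sroot_free/(congr1 (@^~ i)) /=; rewrite eqxx => mi.
by have := m0 i; rewrite -mi.
Qed.

Lemma srefl_notin_B i : ~ B (s i).
Proof. by move=> /(conj_subgroup B_subgroup); exact: conj_srefl_B. Qed.

(** * The two decompositions of a minimal parabolic subgroup *)

Section MinimalParabolic.
Variable i : simple.
Hypothesis sgP : subgroup (minpar D i).
Local Notation alpha := (sroot D i).

Lemma rp_srefl_minpar x : minpar D i (p alpha x * s i).
Proof.
left; exists (p alpha x), 1; split; [by exists x|exact: B1|by rewrite mulr1].
Qed.

Lemma srefl_minpar : minpar D i (s i).
Proof. by have := rp_srefl_minpar 0; rewrite rp0 ?mul1r //; exact: sroot_root. Qed.

Lemma rp_opp_minpar y : minpar D i (p (char_opp alpha) y).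
Proof.
have [x sx] := rp_weyl_rep y (weyl_rep_srefl i) (sroot_root i).
have <- : s i * p alpha x * (s i)^-1 = p (char_opp alpha) y.
  by rewrite sx mulrK ?srefl_unit // char_act_srefl.
apply: subgroup_conj => //; first exact: srefl_minpar.
by right; exact: rp_sroot_B.
Qed.

(* The dense open orbit of U(-alpha) on the projective line P_i/B, obtained by
   translating the decomposition U(alpha) s B `|` B by s. *)
Lemma minpar_opp g : minpar D i g ->
  (exists y b, B b /\ g = p (char_opp alpha) y * b) \/
  (exists b, B b /\ g = s i * b).
Proof.
have su := srefl_unit i; have [_ P1 PM PV] := sgP.
(* Apply the defining decomposition to [(s i)^-1 * h] and move [s i] back across U(alpha). A factor
   [s i * s i] remains, since [s i] is only a representative and its square may differ from 1. *)
have split_s h : minpar D i h ->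
    (exists y b, B b /\ h = p (char_opp alpha) y * s i * s i * b) \/
    (exists b, B b /\ h = s i * b).
  move=> Ph; have : minpar D i ((s i)^-1 * h).
    by apply: (PM) => //; apply: (PV); exact: srefl_minpar.
  case=> [[_ [b [[x _ <-] Bb eh]]]|Bh]; last first.
    by right; exists ((s i)^-1 * h); rewrite mulVKr.
  left; have [y sy] := weyl_rep_rp x (weyl_rep_srefl i) (sroot_root i).
  exists y, b; split=> //; rewrite -char_act_srefl -sy.
  by rewrite -(mulVKr su h) eh !mulrA.
(* Splitting 1 itself absorbs this square into U(-alpha) B; the other case would put [s i] in
   [B]. *)
have [y0 [b0 [Bb0 ess]]] : exists y b, B b /\ s i * s i = p (char_opp alpha) y * b.
  case: (split_s 1) => // [[y [b [Bb e1]]]|[b [Bb e1]]]; last first.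
    case: (@srefl_notin_B i); rewrite -(mulrK (B_unit Bb) (s i)) -e1 mul1r.
    exact: BV.
  exists (- y), b^-1; split; first exact: BV.
  rewrite rpN; last exact: root_opp.
  apply: (mulrI (rp_unit y (root_opp i))); rewrite mulVKr ?rp_unit //; last exact: root_opp.
  by apply: (mulIr (B_unit Bb)); rewrite mulVr ?B_unit // mulrA -e1.
case/split_s => [[y [b [Bb ->]]]|]; [left|by right].
exists (y + y0), (b0 * b); split; first exact: BM.
by rewrite rpD -?mulrA; [rewrite (mulrA (s i)) ess !mulrA|exact: root_opp].
Qed.

End MinimalParabolic.

(** * A single entry of a gallery *)

Section Step.
Variables (v : M) (i : simple) (eps : bool).
Hypothesis Wv : weyl_rep v.
Local Notation alpha := (sroot D i).

(** This and [chart_entry] are one entry of [comb_word] and of [chart_word], isolated so that the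
    local argument does not mention galleries. *)
Definition comb_entry : M := if eps then s i else 1.

Definition chart_entry (y : K) : M :=
  if eps then p alpha y * s i else p (char_opp alpha) y.

Lemma weyl_rep_comb_entry : weyl_rep comb_entry.
Proof. by rewrite /comb_entry; case: eps; [exact: weyl_rep_srefl|exact: weyl_rep1]. Qed.

Local Notation beta := (char_act (v * comb_entry) alpha).

Lemma wall_rootE :
  beta = if eps then char_opp (char_act v alpha) else char_act v alpha.
Proof.
rewrite /comb_entry; case: eps; last by rewrite mulr1.
by rewrite char_actM ?srefl_unit ?weyl_rep_unit // char_act_srefl.
Qed.

Lemma rp_positive_left gamma y : root gamma -> positive D (char_act v gamma) ->
  exists2 c, B c & v * p gamma y = c * v.
Proof.
move=> rg [_ pB]; have [z ->] := weyl_rep_rp y Wv rg.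
by exists (p (char_act v gamma) z) => //; apply: pB; exists z.
Qed.

(** In both cases [v] carries the root of the chart entry to the opposite of [beta]. *)
Lemma not_positive_wall : ~ positive D beta ->
  positive D (char_act v (if eps then alpha else char_opp alpha)).
Proof.
have ra : root (char_act v alpha) by apply: weyl_rep_root => //; exact: sroot_root.
have ro : root (char_opp (char_act v alpha)).
  by rewrite -char_act_opp; apply: weyl_rep_root => //; exact: root_opp.
rewrite wall_rootE; case: eps => npos; last exact: positive_or_opp.
by rewrite -[char_act _ _]char_oppK; apply: positive_or_opp; rewrite ?char_oppK.
Qed.

Lemma chart_entry0 : chart_entry 0 = comb_entry.
Proof.
rewrite /chart_entry /comb_entry; case: eps.
  by rewrite rp0 ?mul1r //; exact: sroot_root.
by rewrite rp0 //; exact: root_opp.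
Qed.

(** If [beta] is not positive, the unipotent factor of the chart entry crosses [v] into [B]; if it
    is positive, that factor is trivial. *)
Lemma chart_entry_left y : (positive D beta -> y = 0) ->
  exists2 c, B c & v * chart_entry y = c * (v * comb_entry).
Proof.
have [pos /(_ pos) ->|npos _] := pselect (positive D beta).
  by exists 1; [exact: B1|rewrite chart_entry0 mul1r].
have := not_positive_wall npos; rewrite /chart_entry /comb_entry.
case: eps => pos.
  have [c Bc vp] := rp_positive_left y (sroot_root i) pos.
  by exists c => //; rewrite !mulrA vp.
have [c Bc vp] := rp_positive_left y (root_opp i) pos.
by exists c => //; rewrite mulr1.
Qed.

Lemma chart_entry_minpar y : subgroup (minpar D i) -> minpar D i (chart_entry y).
Proof.
rewrite /chart_entry; case: eps => sgP; first exact: rp_srefl_minpar.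
exact: rp_opp_minpar.
Qed.

(** The adjacent chambers v(C) and v s(C) differ, which is what rules out the wrong piece of each
    decomposition below. *)
Lemma conj_srefl_neq : conj (v * s i) B <> conj v B.
Proof.
have vu := weyl_rep_unit Wv; rewrite conjM ?srefl_unit // => vs.
have conjK A : conj v^-1 (conj v A) = A by rewrite -conjM ?unitrV // mulVr // conj1.
by apply: (@conj_srefl_B i); rewrite -[LHS]conjK vs conjK.
Qed.

Variable rho : set M -> set M.
Hypothesis rhoP : is_retraction D rho.

Lemma retract_chamber c u b : B c -> weyl_rep u -> B b ->
  rho (conj (c * u * b) B) = conj u B.
Proof.
move=> Bc Wu Bb; have [Nu _] := Wu.
have cuu : c * u \is a GRing.unit by rewrite (unitrMl _ (weyl_rep_unit Wu)) B_unit.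
rewrite (conjM _ cuu (B_unit Bb)) (conj_subgroup B_subgroup Bb).
by apply: rhoP => //; exact: B_parabolic.
Qed.

(** For each sign of [beta] and each value of [eps], one of the two decompositions of P_i has one
    piece consisting of allowed chart entries times [B], while the other piece retracts onto the
    wrong one of v(C) and v s(C). *)
Lemma chart_entryP c h : subgroup (minpar D i) -> B c -> minpar D i h ->
  rho (conj (c * v * h) B) = conj (v * comb_entry) B ->
  exists y b, [/\ B b, h = chart_entry y * b & positive D beta -> y = 0].
Proof.
move=> sgP Bc Ph.
have retract u b c' : v * h = c' * u * b -> B c' -> B b -> weyl_rep u ->
    rho (conj (c * v * h) B) = conj u B.
  move=> vh Bc' Bb Wu; rewrite -(mulrA c) vh !mulrA.
  by apply: retract_chamber => //; exact: BM.
have Wvs : weyl_rep (v * s i) by apply: weyl_repM => //; exact: weyl_rep_srefl.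
have [pos|npos] := pselect (positive D beta).
  (* The good piece is [comb_entry] times [B], so the coordinate is 0; in the bad piece the
     unipotent factor crosses [v] into [B]. *)
  move: (pos); rewrite wall_rootE; have := chart_entry0.
  rewrite /chart_entry /comb_entry; case: eps => e0 pos' rho_h.
    have [[y [b [Bb eh]]]|[b [Bb ->]]] := minpar_opp sgP Ph; last first.
      by exists 0, b; split=> //; rewrite e0.
    have [c' Bc' vp] := rp_positive_left y (root_opp i) pos'.
    case: conj_srefl_neq; rewrite -rho_h.
    by apply: (retract _ b c') => //; rewrite eh mulrA vp.
  case: Ph => [[_ [b [[y _ <-] Bb eh]]]|Bh]; last first.
    by exists 0, h; split=> //; rewrite e0 mul1r.
  have [c' Bc' vp] := rp_positive_left y (sroot_root i) pos'.
  case: conj_srefl_neq; rewrite mulr1 in rho_h; rewrite -rho_h; apply/esym.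
  by apply: (retract _ b c') => //; rewrite eh !mulrA vp.
(* Now the good piece carries a free coordinate, and the bad one has no unipotent factor, so its
   retraction is read off with 1 as left factor. *)
move: npos; rewrite /chart_entry /comb_entry; case: eps => npos rho_h.
  case: Ph => [[_ [b [[y _ <-] Bb eh]]]|Bh]; first by exists y, b; split=> // /npos.
  case: conj_srefl_neq; rewrite -rho_h.
  by apply: (retract _ h 1) => //; rewrite ?mul1r //; exact: B1.
have [|[b [Bb eh]]] := minpar_opp sgP Ph.
  by case=> y [b [Bb eh]]; exists y, b; split=> // /npos.
case: conj_srefl_neq; rewrite mulr1 in rho_h; rewrite -rho_h; apply/esym.
by apply: (retract _ b 1) => //; rewrite ?mul1r ?eh ?mulrA //; exact: B1.
Qed.

End Step.

(** * Induction along a gallery *)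

Section Galleries.
Variables (r : nat) (d : r.-tuple simple).
Implicit Types (g h : 'I_r -> M).

Lemma prefix_prod0 g : prefix_prod g 0 = 1.
Proof. by rewrite /prefix_prod big_pred0. Qed.

Lemma prefix_prodS g (q : 'I_r) : prefix_prod g q.+1 = prefix_prod g q * g q.
Proof.
(* Extending [g] by 1 to all natural numbers turns the filtered product into one over ['I_m], whose
   last factor can be split off. *)
pose F k := if insub k is Some q' then g q' else 1.
have prefixE m : (m <= r)%N -> prefix_prod g m = \prod_(k < m) F k.
  move=> mr; rewrite (big_ord_widen _ _ mr) /prefix_prod.
  by apply: eq_bigr => k _; rewrite /F valK.
by rewrite !prefixE ?ltn_ord // 1?ltnW // big_ord_recr /= /F valK.
Qed.

(** [bs_equiv] constrains only the right factors [b q.+1]; the left factor at [q] is the right one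
    of the preceding position, or 1 at the start. *)
Lemma bs_factor (b : nat -> M) : b 0%N = 1 -> (forall q : 'I_r, B (b q.+1)) ->
  forall q : 'I_r, B (b q).
Proof.
move=> b0 bB [[|m] mr] /=; first by rewrite b0; exact: B1.
exact: (bB (Ordinal (ltnW mr))).
Qed.

Lemma bs_equiv_sym g h : bs_equiv D g h -> bs_equiv D h g.
Proof.
move=> [b [b0 bB hE]]; exists (fun m => (b m)^-1); split=> [|q|q].
- by rewrite b0 invr1.
- exact: BV.
have bq : B (b q) by exact: bs_factor.
by rewrite hE invrK !mulrA mulrK ?(B_unit (bB q)) // divrr ?(B_unit bq) // mul1r.
Qed.

Lemma bs_equiv_trans g h k : bs_equiv D g h -> bs_equiv D h k -> bs_equiv D g k.
Proof.
move=> [b [b0 bB hE]] [c [c0 cB kE]]; exists (fun m => b m * c m); split=> [|q|q].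
- by rewrite b0 c0 mulr1.
- exact: BM.
by rewrite kE hE invrM ?B_unit ?mulrA //; exact: bs_factor.
Qed.

Lemma eq_bs_point g h : bs_equiv D g h -> bs_point D d g = bs_point D d h.
Proof.
move=> gh; apply/seteqP; split=> k [dk] ?; split=> //.
  exact: bs_equiv_trans (bs_equiv_sym gh) _.
exact: bs_equiv_trans gh _.
Qed.

Lemma eq_map_flatten2 (X : Type) (S : eqType) (a a' b b' : S -> X) (u : seq S) (w w' : seq X) :
  flatten [seq [:: a q; b q] | q <- u] ++ w =
    flatten [seq [:: a' q; b' q] | q <- u] ++ w' ->
  {in u, a =1 a'} /\ w = w'.
Proof.
elim: u => //= q u IHu [aq _ /IHu [au ww']]; split=> // q'.
by rewrite inE => /orP[/eqP ->|/au].
Qed.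

Variable rho : set M -> set M.
Hypothesis rhoP : is_retraction D rho.

Lemma map_gallery P g :
  [seq rho F | F <- gallery D d P g] =
  flatten [seq [:: rho (conj (prefix_prod g q) B);
                   rho (conj (prefix_prod g q) (minpar D (tnth d q)))]
          | q : 'I_r <- enum 'I_r]
  ++ [:: rho (conj (prefix_prod g r) B); rho (conj (prefix_prod g r) P)].
Proof. by rewrite map_cat map_flatten -map_comp. Qed.

Lemma retract_gallery_chamber P g g' m : (m <= r)%N ->
  [seq rho F | F <- gallery D d P g] = gallery D d P g' ->
  rho (conj (prefix_prod g m) B) = conj (prefix_prod g' m) B.
Proof.
(* The chamber at index [r] is in the tail of the gallery, the others in the flattened part. *)
rewrite map_gallery leq_eqVlt => /orP[/eqP ->|mr] /eq_map_flatten2 [chambers].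
  by case.
by have := chambers (Ordinal mr) (mem_enum _ _).
Qed.

Variable e : 'I_r -> bool.

Lemma weyl_rep_comb m : (m <= r)%N -> weyl_rep (prefix_prod (comb_word D d e) m).
Proof.
elim: m => [_|m IHm mr]; first by rewrite prefix_prod0; exact: weyl_rep1.
rewrite (prefix_prodS _ (Ordinal mr)); apply: weyl_repM; first by apply: IHm; exact: ltnW.
exact: weyl_rep_comb_entry.
Qed.

Lemma gallery_rootE (q : 'I_r) : gallery_root D d e q =
  char_act (prefix_prod (comb_word D d e) q * comb_entry (tnth d q) (e q))
    (sroot D (tnth d q)).
Proof. by rewrite /gallery_root prefix_prodS. Qed.

Lemma load_bearingP (q : 'I_r) :
  load_bearing D d e q <-> ~ positive D (gallery_root D d e q).
Proof.
rewrite /load_bearing /separates invr1 char_act1 {1 3}/gallery_root.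
rewrite char_actK; last by apply/weyl_rep_unit/weyl_rep_comb/ltn_ord.
by have := positive_sroot (tnth d q); tauto.
Qed.

Hypothesis sgP : forall q, subgroup (minpar D (tnth d q)).

Lemma chart_word_minpars x : in_minpars D d (chart_word D d e x).
Proof. by move=> q; exact: (chart_entry_minpar (e q)). Qed.

(** Each new unipotent factor is moved to the left across the combinatorial prefix and collected in
    [c]. This puts the prefix in the form to which [is_retraction] applies. *)
Lemma prefix_chart x : (forall q, ~ load_bearing D d e q -> x q = 0) ->
  forall m, (m <= r)%N -> exists2 c, B c &
    prefix_prod (chart_word D d e x) m = c * prefix_prod (comb_word D d e) m.
Proof.
move=> x0; elim=> [_|m IHm mr].
  by exists 1; [exact: B1|rewrite !prefix_prod0 mulr1].
have [c Bc cE] := IHm (ltnW mr); pose q := Ordinal mr.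
have [|c' Bc' c'E] := @chart_entry_left _ (tnth d q) (e q) (weyl_rep_comb (ltnW mr)) (x q).
  by move=> pos; apply: x0; rewrite load_bearingP gallery_rootE; apply.
exists (c * c'); first exact: BM.
rewrite !(prefix_prodS _ q) /= cE -mulrA -(mulrA c c'); congr (c * _).
exact: c'E.
Qed.

(** The entries are normalized from left to right: [b] records the corrections by [B], and the last
    clause keeps the prefix in the form required by [chart_entryP] at the next position. *)
Lemma chart_coordinates P g : in_minpars D d g ->
  [seq rho F | F <- gallery D d P g] = gallery D d P (comb_word D d e) ->
  forall m, (m <= r)%N -> exists (x : 'I_r -> K) (b : nat -> M) (c : M),
    [/\ b 0%N = 1, forall k, B (b k),
        forall q : 'I_r, (q < m)%N -> chart_word D d e x q = (b q)^-1 * g q * b q.+1,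
        forall q, ~ load_bearing D d e q -> x q = 0
      & B c /\ prefix_prod g m = c * prefix_prod (comb_word D d e) m * (b m)^-1].
Proof.
move=> dg rho_g; elim=> [_|m IHm mr].
  exists (fun=> 0), (fun=> 1), 1; split=> // [_|]; first exact: B1.
  by split; [exact: B1|rewrite !prefix_prod0 invr1 !mulr1].
have [x [b [c [b0 bB xE x0 [Bc cE]]]]] := IHm (ltnW mr); pose q := Ordinal mr.
have rho_m := retract_gallery_chamber mr rho_g.
(* The correction left over from the previous entry is absorbed into the current one, which stays in
   the minimal parabolic because that contains [B]. *)
have Ph : minpar D (tnth d q) ((b m)^-1 * g q).
  case: (sgP q) => _ _ PM _; apply: (PM) => //; right; exact: BV.
rewrite !(prefix_prodS _ q) /= cE -(mulrA _ (b m)^-1) in rho_m.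
have [y [b' [Bb' hE y0]]] := chart_entryP (weyl_rep_comb (ltnW mr)) rhoP (sgP q) Bc Ph rho_m.
have y0' : ~ load_bearing D d e q -> y = 0.
  move=> nlb; apply: y0; apply: contrapT => npos; apply: nlb.
  by rewrite load_bearingP gallery_rootE.
have [c' Bc' c'E] := chart_entry_left (weyl_rep_comb (ltnW mr)) y0.
(* Since [(b m)^-1 * g q] is the chart entry times [b'], the next correction is [b'^-1]. Earlier
   equations involve [b] only up to index [m], so they survive the update. *)
exists (fun q' => if q' == q then y else x q').
exists (fun k => if k == m.+1 then b'^-1 else b k), (c * c'); split=> [//|k|q'|q'|].
- by case: eqP => _ //; exact: BV.
- rewrite ltnS leq_eqVlt => /orP[/eqP q'm|q'm].
    have -> : q' = q by exact: val_inj.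
    rewrite /chart_word /= !eqxx ltn_eqF // hE mulrK ?B_unit //.
  rewrite ltn_eqF ?ltnS 1?ltnW // eqSS ltn_eqF // -xE //.
  by rewrite /chart_word -val_eqE /= ltn_eqF.
- by case: eqP => [->|_] //; exact: x0.
split; first exact: BM.
rewrite eqxx invrK !(prefix_prodS _ q) /= cE -!mulrA; congr (c * _).
by rewrite hE !mulrA c'E !mulrA.
Qed.

End Galleries.
End Building.

Theorem proposition3 (K : closedFieldType) (n : nat) (D : group_setting K n)
  (rho : set 'M[K]_n.+1 -> set 'M[K]_n.+1)
  (rho_retraction : is_retraction D rho)
  (t0 : {set 'I_(rk D)}) (P : set 'M[K]_n.+1)
  (P_type : parabolic_of_type D t0 P) (P_B : gB D `<=` P)
  (w : 'M[K]_n.+1) (w_N : normalizer (gG D) (gT D) w)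
  (w_min : minimal_representative D t0 w)
  (r : nat) (d : r.-tuple 'I_(rk D)) (d_red : reduced_decomposition D d w)
  (d_minpar : forall q : 'I_r,
     parabolic_of_type D [set tnth d q]%SET (minpar D (tnth d q)))
  (e : 'I_r -> bool) :
  cell D d rho P e =
  [set chart D d e x | x in
     [set x : 'I_r -> K | forall q, ~ load_bearing D d e q -> x q = 0]].
Proof.
have Ppar q : is_parabolic (gG D) (minpar D (tnth d q)) by case: (d_minpar q).
have sgP q : subgroup (minpar D (tnth d q)) by case: (Ppar q) => [[]].
apply/seteqP; split=> [_ [_ [g [dg -> rho_g]]]|_ [x x0 <-]].
  (* At full length, the corrections [b] are an equivalence between [g] and the chart word. *)
  have [x [b [_ [b0 bB xE x0 _]]]] :=
    chart_coordinates rho_retraction sgP dg rho_g (leqnn r).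
  exists x => //; apply/esym/eq_bs_point; exists b; split=> // q.
  exact: xE.
have dx := chart_word_minpars e sgP x.
split; first by exists (chart_word D d e x).
exists (chart_word D d e x); split=> //.
(* Chambers, facets and target are all translates of parabolics containing [B], so one formula
   retracts every face. *)
have rho_prefix Q m : (m <= r)%N -> is_parabolic (gG D) Q -> gB D `<=` Q ->
    rho (conj (prefix_prod (chart_word D d e x) m) Q) =
    conj (prefix_prod (comb_word D d e) m) Q.
  move=> mr parQ BQ; have [c Bc ->] := prefix_chart x0 mr.
  by apply: rho_retraction => //; case: (weyl_rep_comb d e mr).
rewrite map_gallery /gallery; congr (flatten _ ++ [:: _; _]).
- apply: eq_map => q; rewrite !rho_prefix // 1?ltnW //; first by right.
  exact: B_parabolic.
- by apply: rho_prefix => //; exact: B_parabolic.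
by apply: rho_prefix => //; case: P_type.
Qed.
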